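(* In the setting of the context (a Lie superalgebra $\mathfrak{g}=\mathfrak{g}_-\oplus\mathfrak{h}\oplus\mathfrak{g}_+$ satisfying assumptions (1)–(4) and a subset $\Delta_+(\mathfrak{l})\subseteq\Delta_+$ with the stated Levi property), the rational functions $P_{\mathfrak{g},\mathfrak{l}}(\beta_1,\ldots,\beta_\ell)\in U'(\mathfrak{h})$ defined in the context satisfy $$P_{\mathfrak{g},\mathfrak{l}}(\emptyset)=1,$$ $$P_{\mathfrak{g},\mathfrak{l}}(\beta)=\big(-1+\delta_{\beta\in Q_+(\mathfrak{l})}\big)\psi_\beta\qquad\text{for all }\beta\in Q_{\succ0},$$ and for all integers $\ell\ge2$ and all $\beta_1,\ldots,\beta_\ell\in Q_{\succ0}$: $$P_{\mathfrak{g},\mathfrak{l}}(\beta_1,\ldots,\beta_\ell)=-\psi_{\beta_1}P_{\mathfrak{g},\mathfrak{l}}(\beta_1+\beta_2,\beta_3,\ldots,\beta_\ell)+\delta_{\beta_1\in Q_+(\mathfrak{l})}\,\psi_{\beta_1}\,P_{\mathfrak{g},\mathfrak{l}}(\beta_2,\ldots,\beta_\ell)^{\beta_1}.$$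
   Context: Setting. $\mathbb{F}$ is a field of characteristic $0$; $\mathfrak{g}$ is a (not necessarily finite-dimensional) Lie superalgebra over $\mathbb{F}$ with a vector superspace decomposition into three subalgebras $\mathfrak{g}=\mathfrak{g}_-\oplus\mathfrak{h}\oplus\mathfrak{g}_+$ such that: (1) $\mathfrak{h}=\mathfrak{h}_{\bar0}$ (purely even) and $\mathfrak{h}$ is maximal abelian in $\mathfrak{g}$; (2) $\mathfrak{g}_+$ and $\mathfrak{g}_-$ have bases $\{e^i_\beta\}_{\beta\in\Delta_+,i\in I_\beta}$ and $\{f^i_\beta\}_{\beta\in\Delta_+,i\in I_\beta}$ of homogeneous weight vectors, where $\Delta_+\subseteq\mathfrak{h}^\ast$ and the $I_\beta$ are index sets: $[h,e^i_\beta]=\beta(h)e^i_\beta$, $[h,f^i_\beta]=-\beta(h)f^i_\beta$ for all $h\in\mathfrak{h}$; (3) there is $\Omega_0\in U(\mathfrak{h})$ such that $\Omega=\Omega_0+\sum_{\beta\in\Delta_+}\sum_{i\in I_\beta}f^i_\beta e^i_\beta$ defines an operator on $U(\mathfrak{g})/U(\mathfrak{g})\mathfrak{g}_+$ commuting with the action of $U(\mathfrak{g})$; in particular for each $v\in U(\mathfrak{g})/U(\mathfrak{g})\mathfrak{g}_+$, $f^i_\beta e^i_\beta v$ is nonzero for at most finitely many $(\beta,i)$; (4) any element of $U(\mathfrak{g})$ commuting with $\Omega_0$ also commutes with all of $\mathfrak{h}$. Let $Q_+=\mathbb{Z}_{\ge0}\Delta_+\subseteq\mathfrak{h}^\ast$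 and $Q_{\succ0}=Q_+\setminus\{0\}$. The relation $\lambda\preceq\mu\iff\mu-\lambda\in Q_+$ is a partial order on $\mathfrak{h}^\ast$, and $\Delta_+\subseteq Q_{\succ0}$. Let $U'(\mathfrak{h})$ be the fraction field of $U(\mathfrak{h})$. For $\lambda\in\mathfrak{h}^\ast$, $\phi\mapsto\phi^\lambda$ is the unital $\mathbb{F}$-algebra automorphism of $U'(\mathfrak{h})$ determined by $h^\lambda=h+\lambda(h)$, $h\in\mathfrak{h}$. For $\lambda\in Q_{\succ0}$ the element $\Omega_0^\lambda-\Omega_0$ is nonzero, and $\psi_\lambda=\frac{1}{\Omega_0^\lambda-\Omega_0}\in U'(\mathfrak{h})$; $\psi_\lambda^\mu=(\psi_\lambda)^\mu$. Relative data. $\Delta_+(\mathfrak{l})\subseteq\Delta_+$ is a subset such that whenever $\beta_1,\ldots,\beta_k\in\Delta_+$ and $\beta_1+\cdots+\beta_k\in\mathbb{Z}_{\ge0}\Delta_+(\mathfrak{l})$, then all $\beta_i\in\Delta_+(\mathfrak{l})$. The Levi subalgebra $\mathfrak{l}$ is the span of $\mathfrak{h}$ and all $e^i_\beta,f^i_\beta$ with $\beta\in\Delta_+(\mathfrak{l})$. The Levi cone is $Q_+(\mathfrak{l})=\mathbb{Z}_{\ge0}\Delta_+(\mathfrak{l})$. For $\beta\in Q_+$, $\delta_{\beta\in Q_+(\mathfrak{l})}$ is $1$ if $\beta\in Q_+(\mathfrak{l})$ and $0$ otherwise. Coefficients. For $\ell\ge1$ and $\beta_1,\ldots,\beta_\ell\in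 Q_{\succ0}$ put $$E(\beta_1,\ldots,\beta_\ell)=\psi_{\beta_1+\cdots+\beta_\ell}\,\psi^{\beta_1}_{\beta_2+\cdots+\beta_\ell}\cdots\psi^{\beta_1+\cdots+\beta_{\ell-1}}_{\beta_\ell}\in U'(\mathfrak{h}).$$ For $\ell\ge0$ and $\beta_1,\ldots,\beta_\ell\in Q_{\succ0}$ define $P_{\mathfrak{g},\mathfrak{l}}(\beta_1,\ldots,\beta_\ell)\in U'(\mathfrak{h})$ recursively: $P_{\mathfrak{g},\mathfrak{l}}(\emptyset)=1$; if $\ell>0$ and all $\beta_i\in Q_+(\mathfrak{l})$, then $P_{\mathfrak{g},\mathfrak{l}}(\beta_1,\ldots,\beta_\ell)=0$; if $\ell>0$ and at least one $\beta_i\notin Q_+(\mathfrak{l})$, then $$P_{\mathfrak{g},\mathfrak{l}}(\beta_1,\ldots,\beta_\ell)=-\sum_{k=0}^{\ell-1}P_{\mathfrak{g},\mathfrak{l}}(\beta_1,\ldots,\beta_k)\,E(\beta_{k+1},\ldots,\beta_\ell)^{\beta_1+\cdots+\beta_k}.$$ *)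

(* Defs.v *)
From HB Require Import structures.
From mathcomp Require Import all_boot all_order all_algebra.
From mathcomp Require Import ring_quotient.
From mathcomp Require Import boolp classical_sets functions cardinality fsbigop.

Set Implicit Arguments.
Unset Strict Implicit.
Unset Printing Implicit Defensive.

Import GRing.Theory.
Local Open Scope ring_scope.
Local Open Scope quotient_scope.
Local Open Scope quotient_scope.
Local Open Scope quotient_scope.
Local Open Scope quotient_scope.
Local Open Scope quotient_scope.
Local Open Scope quotient_scope.
Local Open Scope quotient_scope.
Local Open Scope quotient_scope.
Local Open Scope quotient_scope.
Local Open Scope quotient_scope.
Local Open Scope quotient_scope.
Local Open Scope quotient_scope.
Local Open Scope quotient_scope.
Local Open Scope quotient_scope.
Local Open Scope quotient_scope.

(* [parity false] and [parity true] are the even and the odd part. *)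
HB.mixin Record isLieSuperalgebra (F : fieldType) g of GRing.Lmodule F g := {
  parity : bool -> {pred g};
  lie : g -> g -> g;
  parity_submod : forall a, submod_closed (parity a);
  parity_cover : forall x : g,
    exists2 x0, x0 \in parity false & x - x0 \in parity true;
  parity_direct : forall x, x \in parity false -> x \in parity true -> x = 0;
  lie_linearl : forall y, linear (fun x => lie x y);
  lie_linearr : forall x, linear (lie x);
  lie_parity : forall a b x y, x \in parity a -> y \in parity b ->
    lie x y \in parity (a (+) b);
  lie_skew : forall a b x y, x \in parity a -> y \in parity b ->
    lie x y = - ((-1) ^+ (a && b) *: lie y x);
  lie_jacobi : forall a b x y z, x \in parity a -> y \in parity b ->
    lie x (lie y z) = lie (lie x y) z + (-1) ^+ (a && b) *: lie y (lie x z)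
}.

#[short(type="lieSuperalgType")]
HB.structure Definition LieSuperalgebra (F : fieldType) :=
  {g of GRing.Lmodule F g & isLieSuperalgebra F g}.

Section LieTheory.
Variables (F : fieldType) (g : lieSuperalgType F).

Lemma lie0r (x : g) : lie x 0 = 0.
Proof.
by have := lie_linearr x (-1) 0 0; rewrite scaler0 addr0 scaleN1r addNr.
Qed.

(* A subalgebra is a subsuperspace closed under the bracket. *)
Record subalgebra := Subalgebra {
  subalg_pred :> {pred g};
  subalg_submod : submod_closed subalg_pred;
  subalg_graded : forall x, x \in subalg_pred ->
    exists2 x0, x0 \in subalg_pred & x0 \in parity false /\ x - x0 \in parity true;
  subalg_lie : forall x y, x \in subalg_pred -> y \in subalg_pred ->
    lie x y \in subalg_pred
}.

HB.instance Definition _ (h : subalgebra) :=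
  GRing.isSubmodClosed.Build F g (subalg_pred h)
    (GRing.submod_closed_semi (subalg_submod h)).

Definition abelian (h : subalgebra) : Prop :=
  forall x y, x \in h -> y \in h -> lie x y = 0.

Definition maximal_abelian (h : subalgebra) : Prop :=
  abelian h /\
  forall a : subalgebra, abelian a -> {subset h <= a} -> {subset a <= h}.

End LieTheory.

Section SubalgebraType.
Variables (F : fieldType) (g : lieSuperalgType F) (h : subalgebra g).

Record subalg_type := SubalgType { subalg_val : g; _ : subalg_val \in h }.

HB.instance Definition _ := [isSub for subalg_val].
HB.instance Definition _ := [Choice of subalg_type by <:].
HB.instance Definition _ := [SubChoice_isSubLmodule of subalg_type by <:].

Definition subalg_parity (a : bool) : {pred subalg_type} :=
  [pred x | val x \in parity a].

Definition subalg_bracket (x y : subalg_type) : subalg_type :=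
  SubalgType (subalg_lie (valP x) (valP y)).

Fact subalg_parity_submod a : submod_closed (subalg_parity a).
Proof.
have [P0 PD] := @parity_submod F g a.
by split=> [|c u v] /=; rewrite !inE ?linear0 // linearP; apply: PD.
Qed.

Fact subalg_parity_cover (x : subalg_type) :
  exists2 x0, x0 \in subalg_parity false & x - x0 \in subalg_parity true.
Proof.
have [x0 hx0 [ex0 ox0]] := subalg_graded (valP x).
by exists (SubalgType hx0); rewrite inE ?linearB.
Qed.

Fact subalg_parity_direct (x : subalg_type) :
  x \in subalg_parity false -> x \in subalg_parity true -> x = 0.
Proof.
by rewrite !inE => ex ox; apply: val_inj; rewrite linear0 (parity_direct _ ex ox).
Qed.

Fact subalg_linearl (y : subalg_type) :
  linear (fun x => subalg_bracket x y).
Proof.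
by move=> a u v; apply: val_inj; rewrite linearP /= lie_linearl.
Qed.

Fact subalg_linearr (x : subalg_type) : linear (subalg_bracket x).
Proof.
by move=> a u v; apply: val_inj; rewrite linearP /= lie_linearr.
Qed.

Fact subalg_bracket_parity a b (x y : subalg_type) :
  x \in subalg_parity a -> y \in subalg_parity b ->
  subalg_bracket x y \in subalg_parity (a (+) b).
Proof. by rewrite !inE => ax bY; apply: lie_parity. Qed.

Fact subalg_skew a b (x y : subalg_type) :
  x \in subalg_parity a -> y \in subalg_parity b ->
  subalg_bracket x y = - ((-1) ^+ (a && b) *: subalg_bracket y x).
Proof.
rewrite !inE => ax bY; apply: val_inj.
by rewrite -scalerN linearZ linearN /= scalerN; apply: (lie_skew a b).
Qed.

Fact subalg_jacobi a b (x y z : subalg_type) :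
  x \in subalg_parity a -> y \in subalg_parity b ->
  subalg_bracket x (subalg_bracket y z) =
    subalg_bracket (subalg_bracket x y) z
    + (-1) ^+ (a && b) *: subalg_bracket y (subalg_bracket x z).
Proof.
rewrite !inE => ax bY; apply: val_inj.
by rewrite linearD linearZ /=; apply: (lie_jacobi a b).
Qed.

HB.instance Definition _ := isLieSuperalgebra.Build F subalg_type
  subalg_parity_submod subalg_parity_cover subalg_parity_direct
  subalg_linearl subalg_linearr subalg_bracket_parity subalg_skew
  subalg_jacobi.

End SubalgebraType.

Arguments subalg_val {F g h}.

Section Enveloping.
Variables (F : fieldType) (g : lieSuperalgType F).

Definition is_lie_hom (A : algType F) (phi : g -> A) : Prop :=
  forall (a b : bool) (x y : g), x \in parity a -> y \in parity b ->
    phi (lie x y) = phi x * phi y - (-1) ^+ (a && b) *: (phi y * phi x).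

(* U(g), given by its universal property *)
Record envelopingAlgebra := EnvelopingAlgebra {
  env_alg :> algType F;
  env_inc : {linear g -> env_alg};
  env_inc_hom : is_lie_hom env_inc;
  env_lift : forall (A : algType F) (phi : {linear g -> A}),
    is_lie_hom phi -> {lrmorphism env_alg -> A};
  env_lift_inc : forall (A : algType F) (phi : {linear g -> A})
    (hom_phi : is_lie_hom phi) (x : g), env_lift hom_phi (env_inc x) = phi x;
  env_lift_uniq : forall (A : algType F) (phi : {linear g -> A})
    (hom_phi : is_lie_hom phi) (f : {lrmorphism env_alg -> A}),
    (forall x, f (env_inc x) = phi x) -> f =1 env_lift hom_phi
}.

Lemma env_ext (U : envelopingAlgebra) (A : algType F) (f1 f2 : {lrmorphism U -> A}) :
  (forall x, f1 (env_inc U x) = f2 (env_inc U x)) -> f1 =1 f2.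
Proof.
move=> ef; pose phi : {linear g -> A} := f2 \o env_inc U.
have hom_phi : is_lie_hom phi.
  move=> a b x y ax bY; rewrite /phi /= (env_inc_hom U ax bY).
  by rewrite linearB linearZ /= !rmorphM.
move=> u; rewrite (env_lift_uniq hom_phi ef).
by rewrite (env_lift_uniq hom_phi (f := f2)).
Qed.

End Enveloping.

Section EnvelopingSub.
Variables (F : fieldType) (g : lieSuperalgType F) (h : subalgebra g).
Variables (Ug : envelopingAlgebra g) (Uh : envelopingAlgebra (subalg_type h)).

Definition sub_inc : {linear subalg_type h -> Ug} :=
  env_inc Ug \o (\val : {linear subalg_type h -> g}).

Fact sub_inc_hom : is_lie_hom sub_inc.
Proof. by move=> a b x y ax bY; exact: (@env_inc_hom F g Ug a b). Qed.

Definition sub_env : {lrmorphism Uh -> Ug} := env_lift Uh sub_inc_hom.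

End EnvelopingSub.

(* The existence of a field of fractions forces A to be a commutative domain. *)
Record fractionField (A : nzRingType) := FractionField {
  frac_field :> fieldType;
  frac_inc : {rmorphism A -> frac_field};
  frac_inj : injective frac_inc;
  frac_quot : forall x : frac_field,
    exists p : A * A, p.2 != 0 /\ x = frac_inc p.1 / frac_inc p.2
}.

Section FracExtend.
Variables (A : nzRingType) (K : fractionField A).

Definition fracn (x : K) : A := (sval (cid (frac_quot x))).1.
Definition fracd (x : K) : A := (sval (cid (frac_quot x))).2.

Lemma fracd_neq0 x : fracd x != 0.
Proof. by rewrite /fracd; case: cid => p []. Qed.

Lemma frac_nd x : x = frac_inc K (fracn x) / frac_inc K (fracd x).
Proof. by rewrite /fracn /fracd; case: cid => p []. Qed.

Definition frac_ext (f : A -> A) (x : K) : K :=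
  frac_inc K (f (fracn x)) / frac_inc K (f (fracd x)).

Lemma frac_inc_eq0 a : (frac_inc K a == 0) = (a == 0).
Proof. by rewrite -(inj_eq (@frac_inj _ K)) rmorph0. Qed.

Variable f : {rmorphism A -> A}.
Hypothesis f_inj : injective f.

Lemma frac_extE a b : b != 0 ->
  frac_ext f (frac_inc K a / frac_inc K b)
  = frac_inc K (f a) / frac_inc K (f b).
Proof.
move=> b0; set x := _ / _; rewrite /frac_ext.
have f0 c : c != 0 -> frac_inc K (f c) != 0.
  by rewrite frac_inc_eq0 -(inj_eq f_inj) rmorph0.
have c0 d : d != 0 -> frac_inc K d != 0 by rewrite frac_inc_eq0.
have := frac_nd x; rewrite {1}/x => /eqP.
rewrite eqr_div ?c0 ?fracd_neq0 // -!rmorphM /= (inj_eq (@frac_inj _ K)).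
move=> /eqP /(congr1 (frac_inc K \o f)) /=; rewrite !rmorphM /= => e.
by apply/eqP; rewrite eqr_div ?f0 ?fracd_neq0 // eq_sym e.
Qed.

End FracExtend.

Section Dual.
Variables (F : fieldType) (V : lmodType F).

Definition dual := {linear V -> F^o}.

HB.instance Definition _ := gen_eqMixin dual.
HB.instance Definition _ := gen_choiceMixin dual.

Implicit Types f k l : dual.

Definition dual_zero : dual := \0.
Definition dual_opp f : dual := \- f.
Definition dual_add f k : dual := f \+ k.

Lemma dual_ext f k : f =1 k -> f = k.
Proof.
case: f => f [[f1] [f2]]; case: k => k [[k1] [k2]] /= e.
have {e} e : f = k by apply: funext.
rewrite e in f1 f2 *.
by rewrite (Prop_irrelevance f1 k1) (Prop_irrelevance f2 k2).
Qed.

Fact dual_addA : associative dual_add.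
Proof. by move=> f k l; apply: dual_ext => x /=; rewrite addrA. Qed.
Fact dual_addC : commutative dual_add.
Proof. by move=> f k; apply: dual_ext => x /=; rewrite addrC. Qed.
Fact dual_add0 : left_id dual_zero dual_add.
Proof. by move=> f; apply: dual_ext => x /=; rewrite add0r. Qed.
Fact dual_addN : left_inverse dual_zero dual_opp dual_add.
Proof. by move=> f; apply: dual_ext => x /=; rewrite addNr. Qed.

HB.instance Definition _ :=
  GRing.isZmodule.Build dual dual_addA dual_addC dual_add0 dual_addN.

End Dual.

Notation weight h := (dual (subalg_type h)).

Section Shift.
Variables (F : fieldType) (g : lieSuperalgType F) (h : subalgebra g).
Hypothesis h_even : {subset h <= parity false}.
Hypothesis h_abelian : abelian h.
Variable Uh : envelopingAlgebra (subalg_type h).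
Implicit Types lam mu : weight h.

(* The shift phi |-> phi^lam sends a generator x of U(h) to x + lam(x). It is
   defined on U(h) by the universal property, then extended to fractions. *)
Definition shift_gen lam (x : subalg_type h) : Uh := env_inc Uh x + (lam x)%:A.

Fact shift_gen_linear lam : linear (shift_gen lam).
Proof.
move=> a x y; rewrite /shift_gen !linearP /= scalerDl -scalerA scalerDr.
by rewrite !addrA; congr (_ + _); rewrite -!addrA; congr (_ + _); rewrite addrC.
Qed.

HB.instance Definition _ lam :=
  GRing.isLinear.Build F (subalg_type h) Uh *:%R (shift_gen lam)
    (shift_gen_linear lam).

Lemma sub_lie0 (x y : subalg_type h) : lie x y = 0.
Proof. by apply: val_inj; rewrite linear0; apply: h_abelian; apply: valP. Qed.

Lemma sub_even (x : subalg_type h) : x \in parity false.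
Proof. by rewrite inE; apply/h_even/valP. Qed.

Lemma env_inc_comm (x y : subalg_type h) :
  env_inc Uh x * env_inc Uh y = env_inc Uh y * env_inc Uh x.
Proof.
apply/eqP; rewrite -subr_eq0; apply/eqP.
have := @env_inc_hom _ _ Uh false false x y (sub_even x) (sub_even y).
by rewrite sub_lie0 linear0 expr0 scale1r => <-.
Qed.

Fact shift_gen_hom lam : is_lie_hom (shift_gen lam).
Proof.
move=> a b x y ax bY; rewrite sub_lie0 linear0.
case: a ax => ax.
  by rewrite (parity_direct _ (sub_even x) ax) linear0 mul0r mulr0 scaler0 subr0.
rewrite expr0 scale1r /shift_gen !(mulrDl, mulrDr) env_inc_comm.
rewrite -!scalerAl -!scalerAr !mul1r !mulr1 !scalerA (mulrC (lam x)).
set u := _ * _; set v := _ *: env_inc Uh x; set w := _ *: env_inc Uh y.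
by rewrite -!addrA [v + (w + _)]addrCA !addrA subrr.
Qed.

Definition shift_env lam : {lrmorphism Uh -> Uh} :=
  env_lift Uh (shift_gen_hom lam).

Lemma shift_env_inc lam x : shift_env lam (env_inc Uh x) = env_inc Uh x + (lam x)%:A.
Proof. by rewrite /shift_env env_lift_inc. Qed.

Lemma shift_envD lam mu a : shift_env lam (shift_env mu a) = shift_env (lam + mu) a.
Proof.
apply: (@env_ext _ _ Uh Uh (shift_env lam \o shift_env mu)) => x /=.
rewrite !shift_env_inc linearD /= shift_env_inc linearZ /= rmorph1 -addrA.
by rewrite -scalerDl.
Qed.

Lemma shift_env0 a : shift_env 0 a = a.
Proof.
apply: (@env_ext _ _ Uh Uh (shift_env 0) idfun) => x /=.
by rewrite shift_env_inc /= scale0r addr0.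
Qed.

Lemma shift_env_inj lam : injective (shift_env lam).
Proof.
move=> a b e; rewrite -[a]shift_env0 -[b]shift_env0 -(addNr lam) -!shift_envD.
by rewrite e.
Qed.

Variable K : fractionField Uh.

Definition shift lam : K -> K := frac_ext (shift_env lam).

Local Notation inc := (frac_inc K).

Lemma shift_frac lam a b : b != 0 ->
  shift lam (inc a / inc b) = inc (shift_env lam a) / inc (shift_env lam b).
Proof. exact/frac_extE/shift_env_inj. Qed.

Lemma shift_inc lam a : shift lam (inc a) = inc (shift_env lam a).
Proof.
by have := shift_frac lam a (oner_neq0 Uh); rewrite !rmorph1 !divr1.
Qed.

Fact shift_zmod_morphism lam : zmod_morphism (shift lam).
Proof.
move=> x y; have [[a b] /= [b0 ->]] := frac_quot x.
have [[c d] /= [d0 ->]] := frac_quot y.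
have f0 (e : Uh) : e != 0 -> inc (shift_env lam e) != 0.
  by rewrite frac_inc_eq0 -(inj_eq (@shift_env_inj lam)) rmorph0.
have n0 (e : Uh) : e != 0 -> inc e != 0 by rewrite frac_inc_eq0.
have bd0 : b * d != 0 by rewrite -(frac_inc_eq0 K) rmorphM mulf_neq0 ?n0.
rewrite -mulNr addf_div ?n0 // -rmorphN -!rmorphM -rmorphD /= !shift_frac //.
rewrite rmorphD !rmorphM rmorphN /= rmorphD !rmorphM rmorphN /=.
by rewrite -addf_div ?f0 // mulNr.
Qed.

Fact shift_monoid_morphism lam : monoid_morphism (shift lam).
Proof.
split=> [|x y]; first by rewrite -{1}(rmorph1 inc) shift_inc !rmorph1.
have [[a b] /= [b0 ->]] := frac_quot x.
have [[c d] /= [d0 ->]] := frac_quot y.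
have n0 (e : Uh) : e != 0 -> inc e != 0 by rewrite frac_inc_eq0.
have bd0 : b * d != 0 by rewrite -(frac_inc_eq0 K) rmorphM mulf_neq0 ?n0.
rewrite mulf_div -!rmorphM /= !shift_frac // mulf_div.
by rewrite !(rmorphM (shift_env lam)) /= !(rmorphM inc).
Qed.

HB.instance Definition _ lam :=
  GRing.isZmodMorphism.Build K K (shift lam) (shift_zmod_morphism lam).
HB.instance Definition _ lam :=
  GRing.isMonoidMorphism.Build K K (shift lam) (shift_monoid_morphism lam).

Lemma shift_scalar lam c : shift lam (inc c%:A) = inc c%:A.
Proof. by rewrite shift_inc linearZ /= rmorph1. Qed.

Lemma shift_gen_inc lam x :
  shift lam (inc (env_inc Uh x)) = inc (env_inc Uh x) + inc (lam x)%:A.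
Proof. by rewrite shift_inc shift_env_inc rmorphD. Qed.

Lemma shift_bij lam : bijective (shift lam).
Proof.
have sD m1 m2 x : m1 + m2 = 0 -> shift m1 (shift m2 x) = x.
  move=> e; rewrite {1}[x]frac_nd shift_frac ?fracd_neq0 // shift_frac; last first.
    by rewrite -(rmorph0 (shift_env m2)) (inj_eq (@shift_env_inj m2)) fracd_neq0.
  by rewrite !shift_envD e !shift_env0 -frac_nd.
by exists (shift (- lam)) => x; apply: sD; rewrite ?addNr ?addrN.
Qed.

End Shift.

Definition is_basis (F : fieldType) (V : lmodType F) (J : choiceType)
    (D : set J) (v : J -> V) (A : {pred V}) : Prop :=
  [/\ forall j, D j -> v j \in A,
      forall (r : seq J) (c : J -> F), uniq r -> (forall j, j \in r -> D j) ->
        \sum_(j <- r) c j *: v j = 0 -> forall j, j \in r -> c j = 0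
    & forall x, x \in A -> exists (r : seq J) (c : J -> F),
        (forall j, j \in r -> D j) /\ x = \sum_(j <- r) c j *: v j].

Record triangular (F : fieldType) (g : lieSuperalgType F) := Triangular {
  nminus : subalgebra g;
  cartan : subalgebra g;
  nplus : subalgebra g;
  tri_cover : forall x : g, exists y h z,
    [/\ y \in nminus, h \in cartan, z \in nplus & x = y + h + z];
  tri_direct : forall y h z, y \in nminus -> h \in cartan -> z \in nplus ->
    y + h + z = 0 -> [/\ y = 0, h = 0 & z = 0];
  cartan_even : {subset cartan <= parity false};
  cartan_maximal : maximal_abelian cartan;
  (* Delta_+, the index sets I_beta, the root vectors e and f; the values of
     the last three outside Delta_+ are irrelevant *)
  pos_roots : set (weight cartan);
  ridx : weight cartan -> choiceType;
  evec : forall b, ridx b -> g;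
  fvec : forall b, ridx b -> g;
  evec_homogeneous : forall b (i : ridx b), pos_roots b ->
    exists a, evec i \in parity a;
  fvec_homogeneous : forall b (i : ridx b), pos_roots b ->
    exists a, fvec i \in parity a;
  evec_weight : forall b (i : ridx b) (h : subalg_type cartan), pos_roots b ->
    lie (val h) (evec i) = (b h : F) *: evec i;
  fvec_weight : forall b (i : ridx b) (h : subalg_type cartan), pos_roots b ->
    lie (val h) (fvec i) = - ((b h : F) *: fvec i);
  evec_basis : is_basis [set p : {b : weight cartan & ridx b} | pos_roots (tag p)]
    (fun p => evec (tagged p)) nplus;
  fvec_basis : is_basis [set p : {b : weight cartan & ridx b} | pos_roots (tag p)]
    (fun p => fvec (tagged p)) nminus
}.

Arguments pos_roots {F g} t _.
Arguments ridx {F g} t _.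

Definition cartan_alg F (g : lieSuperalgType F) (T : triangular g) :=
  subalg_type (cartan T).
Notation hweight T := (weight (cartan T)).

Definition root_index F (g : lieSuperalgType F) (T : triangular g) : choiceType :=
  {b : hweight T & ridx T b}.

Definition root_indices F (g : lieSuperalgType F) (T : triangular g) :
    set (root_index T) :=
  [set p | pos_roots T (tag p)].
Arguments root_indices {F g} T _.

Section Verma.
Variables (F : fieldType) (g : lieSuperalgType F) (T : triangular g).
Variable Ug : envelopingAlgebra g.

(* the left ideal U(g)g_+ of U(g) *)
Definition nplus_ideal : {pred Ug} :=
  [pred y | `[< exists n (u : 'I_n -> Ug) (x : 'I_n -> g),
     (forall i, x i \in nplus T) /\ y = \sum_(i < n) u i * env_inc Ug (x i) >]].

Lemma nplus_idealP y : reflect (exists n (u : 'I_n -> Ug) (x : 'I_n -> g),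
    (forall i, x i \in nplus T) /\ y = \sum_(i < n) u i * env_inc Ug (x i))
  (y \in nplus_ideal).
Proof. exact: asboolP. Qed.

Fact nplus_ideal_zmod : zmod_closed nplus_ideal.
Proof.
split=> [|y1 y2].
  apply/nplus_idealP; exists 0%N, (fun=> 0), (fun=> 0).
  by split=> [[] //|]; rewrite big_ord0.
move=> /nplus_idealP[n1 [u1 [x1 [h1 ->]]]] /nplus_idealP[n2 [u2 [x2 [h2 ->]]]].
apply/nplus_idealP; exists (n1 + n2)%N.
exists (fun i => match fintype.split i with inl j => u1 j | inr j => - u2 j end).
exists (fun i => match fintype.split i with inl j => x1 j | inr j => x2 j end).
split=> [i|]; first by case: fintype.split.
rewrite big_split_ord /= -sumrN; congr (_ + _); apply: eq_bigr => i _.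
  by rewrite (unsplitK (inl _ i)).
by rewrite (unsplitK (inr _ i)) mulNr.
Qed.

HB.instance Definition _ := GRing.isZmodClosed.Build Ug nplus_ideal nplus_ideal_zmod.

Lemma nplus_idealMl (u y : Ug) : y \in nplus_ideal -> u * y \in nplus_ideal.
Proof.
move=> /nplus_idealP[n [v [x [hx ->]]]]; apply/nplus_idealP.
exists n, (fun i => u * v i), x; split=> //.
by rewrite mulr_sumr; apply: eq_bigr => i _; rewrite mulrA.
Qed.

(* U(g)/U(g)g_+ *)
Definition verma := Quotient.quot nplus_ideal.
HB.instance Definition _ := ZmodQuotient.on verma.

Definition verma_scale (u : Ug) (m : verma) : verma := \pi_verma (u * repr m).

Lemma verma_scale_pi (u y : Ug) : verma_scale u (\pi_verma y) = \pi_verma (u * y).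
Proof.
apply/eqP; rewrite -Quotient.idealrBE -mulrBr; apply: nplus_idealMl.
by rewrite Quotient.idealrBE reprK.
Qed.

Fact verma_scaleA (u v : Ug) (m : verma) :
  verma_scale u (verma_scale v m) = verma_scale (u * v) m.
Proof.
by rewrite -[m]reprK (verma_scale_pi v) (verma_scale_pi u) verma_scale_pi mulrA.
Qed.

Fact verma_scale1 : left_id 1 verma_scale.
Proof. by move=> m; rewrite -[m]reprK verma_scale_pi mul1r. Qed.

Fact verma_scaleDr : right_distributive verma_scale +%R.
Proof.
move=> u m1 m2; rewrite -[m1]reprK -[m2]reprK -raddfD.
by rewrite !verma_scale_pi mulrDr raddfD.
Qed.

Fact verma_scaleDl (m : verma) : {morph verma_scale^~ m : u v / u + v}.
Proof.
by move=> u v; rewrite -[m]reprK !verma_scale_pi mulrDl raddfD.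
Qed.

HB.instance Definition _ := GRing.Zmodule_isLmodule.Build Ug verma
  verma_scaleA verma_scale1 verma_scaleDr verma_scaleDl.

Variable Uh : envelopingAlgebra (cartan_alg T).

Definition Omega_term (p : root_index T) (m : verma) : verma :=
  (env_inc Ug (fvec (tagged p)) * env_inc Ug (evec (tagged p))) *: m.

Definition Omega_locally_finite : Prop := forall m : verma,
  finite_set [set p | root_indices T p /\ Omega_term p m <> 0].

Definition Omega (Omega0 : Uh) (m : verma) : verma :=
  sub_env Ug Uh Omega0 *: m + \sum_(p \in root_indices T) Omega_term p m.

Definition Omega_commutes (Omega0 : Uh) : Prop :=
  Omega_locally_finite /\
  forall (u : Ug) (m : verma), Omega Omega0 (u *: m) = u *: Omega Omega0 m.

Definition Omega0_separates (Omega0 : Uh) : Prop :=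
  forall u : Ug, GRing.comm u (sub_env Ug Uh Omega0) ->
  forall x, x \in cartan T -> GRing.comm u (env_inc Ug x).

End Verma.

(* nonnegative integer combinations of elements of D, as sums of lists *)
Definition cone (V : zmodType) (D : set V) : set V :=
  [set l | exists s : seq V, (forall b, b \in s -> D b) /\ l = \sum_(b <- s) b].

Definition pos_cone (V : zmodType) (D : set V) : set V :=
  [set l | cone D l /\ l <> 0].

Definition preceq (V : zmodType) (D : set V) (l m : V) : Prop := cone D (m - l).

Definition partial_order (V : Type) (r : V -> V -> Prop) : Prop :=
  [/\ forall l, r l l,
      forall l m, r l m -> r m l -> l = m
    & forall l m n, r l m -> r m n -> r l n].

(* D is Delta_+ and L is the set Delta_+(l) of roots of the Levi subalgebra l *)
Definition levi_subset (V : zmodType) (D L : set V) : Prop :=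
  (forall b, L b -> D b) /\
  forall s : seq V, (forall b, b \in s -> D b) ->
    cone L (\sum_(b <- s) b) -> forall b, b \in s -> L b.

Section Coefficients.
Variables (F : fieldType) (g : lieSuperalgType F) (T : triangular g).
Variables (Uh : envelopingAlgebra (cartan_alg T)) (K : fractionField Uh).
Variable Omega0 : Uh.
Variable L : set (hweight T).
Implicit Types (lam b : hweight T) (s : seq (hweight T)).

(* phi^lam, written [hshift lam phi] *)
Definition hshift lam : {rmorphism K -> K} :=
  shift (@cartan_even _ _ T) (proj1 (@cartan_maximal _ _ T)) (K := K) lam.

Definition psi lam : K :=
  (hshift lam (frac_inc K Omega0) - frac_inc K Omega0)^-1.

Definition wsum s : hweight T := \sum_(b <- s) b.

Definition coefE s : K :=
  \prod_(k < size s) hshift (wsum (take k s)) (psi (wsum (drop k s))).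

(* n bounds the recursion depth; coefP_nil, coefP_levi and coefP_rec are the
   defining recursion of P *)
Fixpoint coefP_upto n s : K :=
  if n is n'.+1 then
    if s is [::] then 1
    else if `[< forall b, b \in s -> cone L b >] then 0
    else - \sum_(k < size s)
             coefP_upto n' (take k s)
             * hshift (wsum (take k s)) (coefE (drop k s))
  else 1.

Definition coefP s : K := coefP_upto (size s) s.

Lemma coefP_upto_size n s : (size s <= n)%N -> coefP_upto n s = coefP s.
Proof.
rewrite /coefP; elim/ltn_ind: n s => -[|n] IHn s.
  by case: s.
case: s => [|b s] //= sn; case: asboolP => // _.
congr (- _); apply: eq_bigr => k _; congr (_ * _).
have kn : (size (take k (b :: s)) <= size s)%N.
  by rewrite size_takel; case: k => k //= /ltnW.
by rewrite !IHn //; apply: leq_trans kn _.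
Qed.

Lemma coefP_nil : coefP [::] = 1.
Proof. by []. Qed.

Lemma coefP_levi s : s != [::] -> (forall b, b \in s -> cone L b) ->
  coefP s = 0.
Proof. by case: s => // b s _ h; rewrite /coefP /=; case: asboolP. Qed.

Lemma coefP_rec s : (exists2 b, b \in s & ~ cone L b) ->
  coefP s = - \sum_(k < size s)
    coefP (take k s) * hshift (wsum (take k s)) (coefE (drop k s)).
Proof.
case: s => [[c]//|b s [c cs nc]]; rewrite {1}/coefP /=; case: asboolP => [h|_].
  by case: nc; apply: h.
congr (- _); apply: eq_bigr => k _; congr (_ * _); apply: coefP_upto_size.
by rewrite size_takel; case: k => k //= /ltnW.
Qed.

End Coefficients.

(* Main.v *)
Require Import Defs.
From mathcomp Require Import all_boot all_order all_algebra.
From mathcomp Require Import boolp classical_sets functions cardinality fsbigop.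
From mathcomp Require Import ring.

Import GRing.Theory.
Local Open Scope classical_set_scope.
Local Open Scope ring_scope.

(** Write [w(lam)] for the shift of [Omega0] by [lam], so that [psi_lam] shifted
    by [mu] is [1 / (w(lam + mu) - w(mu))].  If [w_j] is the value of [w] at the
    [j]-th partial sum of [b1, ..., bl], then the factor multiplying the [k]-th
    term in the recursion for [P] is the product of the [1 / (w_l - w_j)] over
    [k <= j < l].

    When every [b_i] lies in the Levi cone, all three values of [P] in the
    recurrence vanish.  Otherwise induct on the length: expand [P(b1, b2, s)] by
    its definition and apply the recurrence to each prefix of length [k >= 2].
    The factor of such a term depends on [b1, b2] only through [b1 + b2] and is
    also the shift by [b1] of the factor that goes with the prefix [b2, ...] of
    [b2, s].  So the defining recursions of [P(b1 + b2, s)] and, if [b1] lies in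
    the Levi cone, of [P(b2, s)] sum these terms in closed form.  The Levi
    property ensures that [P(b1 + b2, s)] is indeed governed by the recursion
    and not by the vanishing clause: [b1 + b2] lies in the Levi cone only if
    both [b1] and [b2] do.

    The terms for [k = 0] and [k = 1], together with the leading terms [E] of
    the two sums, leave the discrepancy
    [E(b1, b2, s) + psi_b1 E(b1 + b2, s) - psi_b1 E(b2, s)^b1], whether or not
    [b1] lies in the Levi cone.  It is zero by [coefE_merge], which is the
    partial fraction identity
    [1/((w_l - w_0)(w_l - w_1)) + 1/((w_1 - w_0)(w_l - w_0))
     = 1/((w_1 - w_0)(w_l - w_1))]
    times a common factor. *)

(** * Cones *)

Section Cones.
Set Implicit Arguments.
Unset Strict Implicit.
Variable V : zmodType.
Implicit Types (D L : set V) (x y : V).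

Lemma coneD D x y : cone D x -> cone D y -> cone D (x + y).
Proof.
move=> [s [hs ->]] [t [ht ->]]; exists (s ++ t); rewrite big_cat; split=> // b.
by rewrite mem_cat => /orP[/hs|/ht].
Qed.

(** Decompose both summands into roots: their concatenation sums to an element
    of the Levi cone, so each of these roots is a Levi root. *)
Lemma levi_cone_add D L x y : levi_subset D L -> cone D x -> cone D y ->
  cone L (x + y) <-> cone L x /\ cone L y.
Proof.
move=> [_ levi] [s [hs ->]] [t [ht ->]]; split=> [|[]]; last exact: coneD.
rewrite -big_cat => hst.
have st b : b \in s ++ t -> L b.
  by apply: levi hst b => b; rewrite mem_cat => /orP[/hs|/ht].
by split; [exists s | exists t]; split=> // b hb;
  apply: st; rewrite mem_cat hb ?orbT.
Qed.

(** Antisymmetry of the cone order excludes that the sum is zero. *)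
Lemma pos_cone_add D x y : partial_order (preceq D) ->
  pos_cone D x -> cone D y -> pos_cone D (x + y).
Proof.
move=> [_ anti _] [cx x0] cy; split; first exact: coneD.
move=> xy0; apply: x0; apply: anti; rewrite /preceq; last by rewrite subr0.
by rewrite sub0r; have /eqP := xy0; rewrite addrC addr_eq0 => /eqP <-.
Qed.

End Cones.

(** * Shifts and the products E *)

Section Recurrence.
Set Implicit Arguments.
Unset Strict Implicit.
Variables (F : fieldType) (g : lieSuperalgType F) (T : triangular g).
Variables (Uh : envelopingAlgebra (cartan_alg T)) (K : fractionField Uh).
Variable Omega0 : Uh.
Implicit Types (lam mu b : hweight T) (s : seq (hweight T)).

Local Notation hsh := (hshift K).
Local Notation Psi := (psi K Omega0).
Local Notation E := (Defs.coefE K Omega0).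

Lemma hshift_inc lam a : hsh lam (frac_inc K a) =
  frac_inc K (shift_env (@cartan_even _ _ T) (proj1 (@cartan_maximal _ _ T)) Uh
                lam a).
Proof. exact: shift_inc. Qed.

Lemma hshiftD lam mu x : hsh lam (hsh mu x) = hsh (lam + mu) x.
Proof.
have [[a b] [_ ->]] := frac_quot x.
rewrite (fmorph_div (hsh mu)) (fmorph_div (hsh lam)) (fmorph_div (hsh (_ + _))).
by rewrite !hshift_inc !shift_envD.
Qed.

Lemma hshift0 x : hsh 0 x = x.
Proof.
have [[a b] [_ ->]] := frac_quot x.
by rewrite (fmorph_div (hsh 0)) !hshift_inc !shift_env0.
Qed.

Lemma wsum_cons b s : wsum (b :: s) = b + wsum s.
Proof. by rewrite /wsum big_cons. Qed.

Lemma wsum_nil : wsum ([::] : seq (hweight T)) = 0.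
Proof. by rewrite /wsum big_nil. Qed.

Lemma coefE_cons b s : E (b :: s) = Psi (wsum (b :: s)) * hsh b (E s).
Proof.
rewrite /Defs.coefE /= big_ord_recl /= wsum_nil hshift0 rmorph_prod /=.
congr (_ * _); apply: eq_bigr => k _.
by rewrite wsum_cons -hshiftD.
Qed.

(** Partial fractions for the values of the shifted [Omega0] at the weights
    [0], [b] and [b + lam]. *)
Lemma psi_partial_fractions b lam :
    let nondeg mu := hsh mu (frac_inc K Omega0) - frac_inc K Omega0 != 0 in
    nondeg b -> nondeg lam -> nondeg (b + lam) ->
  Psi (b + lam) * hsh b (Psi lam) + Psi b * Psi (b + lam)
    = Psi b * hsh b (Psi lam).
Proof.
move=> nondeg; rewrite /nondeg /psi => nb nl nbl.
have := nl; rewrite -(fmorph_eq0 (hsh b)) fmorphV rmorphB.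
rewrite (hshiftD b lam).
move: nb nbl; set w0 := frac_inc K Omega0.
set w1 := hsh b w0; set w2 := hsh (b + lam) w0.
move=> n10 n20 n21.
by field; rewrite n10 n20 n21.
Qed.

(** The products on the two sides differ only in their first two factors,
    to which the partial fractions apply. *)
Lemma coefE_merge D b1 b2 s : partial_order (preceq D) ->
    (forall lam, pos_cone D lam ->
       hsh lam (frac_inc K Omega0) - frac_inc K Omega0 != 0) ->
    (forall b, b \in [:: b1, b2 & s] -> pos_cone D b) ->
  E [:: b1, b2 & s] + Psi b1 * E (b1 + b2 :: s) = Psi b1 * hsh b1 (E (b2 :: s)).
Proof.
move=> ord nondeg pos.
have sum_pos : pos_cone D (wsum (b2 :: s)).
  have: forall b, b \in b2 :: s -> pos_cone D b.
    by move=> b bs; apply: pos; rewrite inE bs orbT.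
  rewrite wsum_cons; elim: s b2 {pos} => [|b3 s IHs] b2 pos.
    by rewrite wsum_nil addr0; apply: pos; rewrite mem_head.
  rewrite wsum_cons; apply: pos_cone_add ord _ _.
    by apply: pos; rewrite mem_head.
  by apply: proj1 (IHs _ _) => b bs; apply: pos; rewrite inE bs orbT.
have pos1 : pos_cone D b1 by apply: pos; rewrite mem_head.
have pos12 : pos_cone D (b1 + wsum (b2 :: s)).
  by apply: pos_cone_add ord pos1 (proj1 sum_pos).
have := psi_partial_fractions (nondeg _ pos1) (nondeg _ sum_pos)
  (nondeg _ pos12).
rewrite !coefE_cons (rmorphM (hsh b1)) hshiftD !wsum_cons addrA => pf.
rewrite mulrA [RHS]mulrA -pf; ring.
Qed.

(** * The recurrence *)

Variable L : set (hweight T).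
Local Notation P := (coefP K Omega0 L).

(** Merging [b1] with [b2], or dropping [b1], turns a prefix of length at least
    2 into a nonempty one, so the induction produces sums over the nonempty
    prefixes only: the empty prefix of the defining recursion is split off. *)
Lemma coefP_prefix_sum b s : (exists2 c, c \in b :: s & ~ cone L c) ->
  \sum_(k < size s) P (b :: take k s) * hsh (b + wsum (take k s)) (E (drop k s))
    = - (P (b :: s) + E (b :: s)).
Proof.
move=> /coefP_rec -> /=; rewrite big_ord_recl /= wsum_nil hshift0 coefP_nil mul1r.
rewrite opprD opprK addrAC subrr add0r.
by apply: eq_bigr => k _; rewrite wsum_cons.
Qed.

Lemma coefP_singleton b : P [:: b] = (- 1 + (`[< cone L b >])%:R) * Psi b.
Proof.
case: asboolP => [Lb|nLb].
  by rewrite addNr mul0r coefP_levi // => c; rewrite inE => /eqP ->.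
have := @coefP_prefix_sum b [::]; rewrite big_ord0 coefE_cons wsum_cons wsum_nil.
rewrite addr0 /Defs.coefE big_ord0 rmorph1 mulr1 addr0 mulN1r => e.
apply/eqP; rewrite -addr_eq0 -oppr_eq0 -e //.
by exists b; rewrite ?mem_head.
Qed.

Lemma coefP_recurrence D b1 b2 s : partial_order (preceq D) ->
    (forall lam, pos_cone D lam ->
       hsh lam (frac_inc K Omega0) - frac_inc K Omega0 != 0) ->
    levi_subset D L ->
    (forall b, b \in [:: b1, b2 & s] -> pos_cone D b) ->
  P [:: b1, b2 & s] = - (Psi b1 * P (b1 + b2 :: s))
    + (`[< cone L b1 >])%:R * Psi b1 * hsh b1 (P (b2 :: s)).
Proof.
move=> ord nondeg levi; have [n] := ubnP (size s); elim: n s => // n IHn s sn pos.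
have [c1 c2] : cone D b1 /\ cone D b2.
  by split; apply: (proj1 (pos _ _)); rewrite !inE eqxx ?orbT.
have levi12 := levi_cone_add levi c1 c2.
have [all_levi|] := pselect (forall b, b \in [:: b1, b2 & s] -> cone L b).
  have levi2s b : b \in b2 :: s -> cone L b.
    by move=> bs; apply: all_levi; rewrite inE bs orbT.
  have levi12s b : b \in b1 + b2 :: s -> cone L b.
    rewrite inE => /orP[/eqP -> | bs]; last by apply: levi2s; rewrite inE bs orbT.
    by apply/levi12; split; apply: all_levi; rewrite !inE eqxx ?orbT.
  by rewrite !coefP_levi // rmorph0 !mulr0 oppr0 addr0.
move=> /existsNP[c /not_implyP[cs nc]].
have exc : exists2 c, c \in [:: b1, b2 & s] & ~ cone L c by exists c.
have exc12 : exists2 c, c \in b1 + b2 :: s & ~ cone L c.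
  move: cs; rewrite !inE orbA => /orP[c12|cs]; last first.
    by exists c; rewrite ?inE ?cs ?orbT.
  exists (b1 + b2); rewrite ?mem_head // => /levi12[l1 l2].
  by case/orP: c12 => /eqP e; apply: nc; rewrite e.
have merge := coefE_merge ord nondeg pos.
pose tail b := \sum_(k < size s)
  P (b :: take k s) * hsh (b + wsum (take k s)) (E (drop k s)).
have tail12 : tail (b1 + b2) = - (P (b1 + b2 :: s) + E (b1 + b2 :: s)).
  exact: coefP_prefix_sum exc12.
set d : K := (`[< cone L b1 >])%:R.
(* If [b1] is in the Levi cone, the weight outside the cone is [b2] or lies in
   [s]; if not, [d] is zero. *)
have tail2 : d * hsh b1 (tail b2)
    = - (d * (hsh b1 (P (b2 :: s)) + hsh b1 (E (b2 :: s)))).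
  rewrite /d; case: asboolP => [l1|_]; last by rewrite !mul0r oppr0.
  rewrite /tail coefP_prefix_sum ?(rmorphN (hsh b1)) ?(rmorphD (hsh b1)) ?mulrN //.
  by move: cs; rewrite inE => /orP[/eqP e|]; [case: nc; rewrite e | exists c].
have expand : P [:: b1, b2 & s] + E [:: b1, b2 & s]
    = - ((- 1 + d) * Psi b1 * hsh b1 (E (b2 :: s))
         + (- (Psi b1 * tail (b1 + b2)) + Psi b1 * (d * hsh b1 (tail b2)))).
  apply: oppr_inj; rewrite opprK -(coefP_prefix_sum exc) big_ord_recl.
  rewrite take0 drop0 wsum_nil addr0 coefP_singleton; congr (_ + _).
  rewrite /tail (rmorph_sum (hsh b1)) !mulr_sumr -sumrN -big_split.
  apply: eq_bigr => k _ /=; rewrite wsum_cons -/(hsh _) IHn.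
  + rewrite (rmorphM (hsh b1)) hshiftD addrA; ring.
  + by rewrite size_takel ?(ltnW (ltn_ord k)) //; exact: leq_trans (ltn_ord k) sn.
  + move=> b; rewrite !inE orbA => /orP[bb|/mem_take bs]; apply: pos;
      by rewrite !inE orbA ?bb ?bs ?orbT.
apply: (addIr (E [:: b1, b2 & s])); rewrite expand tail12 tail2.
rewrite (_ : E [:: b1, b2 & s] = Psi b1 * hsh b1 (E (b2 :: s))
  - Psi b1 * E (b1 + b2 :: s)); last by rewrite -merge addrK.
ring.
Qed.

End Recurrence.

Theorem theorem5p2 (F : fieldType) (charF0 : [pchar F] =i pred0)
    (g : lieSuperalgType F) (T : triangular g)
    (Ug : envelopingAlgebra g) (Uh : envelopingAlgebra (cartan_alg T))
    (K : fractionField Uh) (Omega0 : Uh)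
    (Omega_comm : Omega_commutes Ug Omega0)
    (Omega0_sep : Omega0_separates Ug Omega0)
    (order_preceq : partial_order (preceq (pos_roots T)))
    (pos_roots_pos : pos_roots T `<=` pos_cone (pos_roots T))
    (Omega0_shift : forall lam : hweight T, pos_cone (pos_roots T) lam ->
       hshift K lam (frac_inc K Omega0) - frac_inc K Omega0 != 0)
    (L : set (hweight T)) (leviL : levi_subset (pos_roots T) L) :
  [/\ coefP K Omega0 L [::] = 1,
      forall b : hweight T, pos_cone (pos_roots T) b ->
        coefP K Omega0 L [:: b] =
          (- 1 + (`[< cone L b >])%:R) * psi K Omega0 b
    & forall (b1 b2 : hweight T) (s : seq (hweight T)),
        (forall b, b \in [:: b1, b2 & s] -> pos_cone (pos_roots T) b) ->
        coefP K Omega0 L [:: b1, b2 & s] =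
          - (psi K Omega0 b1 * coefP K Omega0 L (b1 + b2 :: s))
          + (`[< cone L b1 >])%:R * psi K Omega0 b1
            * hshift K b1 (coefP K Omega0 L (b2 :: s)) ].
Proof.
split; first exact: coefP_nil.
- by move=> b _; apply: coefP_singleton.
- by move=> b1 b2 s; apply: coefP_recurrence order_preceq Omega0_shift leviL.
Qed.
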